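(* There exists a randomized algorithm which, given cut-query oracle access to an unweighted, undirected simple graph $G=(V,E)$ on $n$ vertices and two distinct vertices $s,t\in V$, makes $\widetilde{O}(n^{5/3})$ queries and with high probability outputs an exact minimum $s$-$t$ cut of $G$.
   Context: A cut query takes a set $S\subseteq V$ and returns $c(S)$, the number of edges of $G$ with exactly one endpoint in $S$. A minimum $s$-$t$ cut is a set $S\subseteq V$ with $s\in S$, $t\notin S$ minimizing $c(S)$. $\widetilde{O}(x)$ denotes $O(x\cdot \mathrm{polylog}(x))$. ''With high probability'' means with probability at least $1-n^{-\Omega(1)}$. *)

(* Defs.v *)
From mathcomp Require Import all_boot all_order all_algebra.
Set Implicit Arguments. Unset Strict Implicit. Unset Printing Implicit Defensive.
Import Order.TTheory GRing.Theory Num.Theory.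

Definition simple_graph (n : nat) (e : rel 'I_n) : Prop :=
  symmetric e /\ irreflexive e.

(* c(S): number of edges with exactly one endpoint in S.  Each such edge {u,v}
   is counted once, as the ordered pair (u,v) with u \in S and v \notin S. *)
Definition cut_value (n : nat) (e : rel 'I_n) (S : {set 'I_n}) : nat :=
  #|[set p : 'I_n * 'I_n | [&& e p.1 p.2, p.1 \in S & p.2 \notin S]]|.

Definition is_min_st_cut (n : nat) (e : rel 'I_n) (s t : 'I_n) (S : {set 'I_n}) : bool :=
  [&& s \in S, t \notin S &
      [forall S' : {set 'I_n},
         (s \in S') ==> (t \notin S') ==> (cut_value e S <= cut_value e S')]].

(* A randomized cut-query algorithm over vertex set 'I_n returning an A:
   an (adaptive) decision tree that may return, issue a cut query (and
   continue depending on the answer), or flip a fair coin. *)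
Inductive qalg (n : nat) (A : Type) : Type :=
| QRet of A
| QQuery of {set 'I_n} & (nat -> qalg n A)
| QFlip of (bool -> qalg n A).

Arguments QRet {n A}.
Arguments QQuery {n A}.
Arguments QFlip {n A}.

Fixpoint nqueries (n : nat) (A : Type) (c : {set 'I_n} -> nat) (a : qalg n A) : nat :=
  match a with
  | QRet _ => 0
  | QQuery Q k => (nqueries c (k (c Q))).+1
  | QFlip k => maxn (nqueries c (k true)) (nqueries c (k false))
  end.

Fixpoint succ_prob (n : nat) (A : Type) (c : {set 'I_n} -> nat) (P : pred A)
  (a : qalg n A) : rat :=
  match a with
  | QRet r => if P r then 1 else 0
  | QQuery Q k => succ_prob c P (k (c Q))
  | QFlip k => (succ_prob c P (k true) + succ_prob c P (k false)) / 2%:R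
  end%R.

(* Main.v *)
Require Import Defs.
From mathcomp Require Import all_boot all_order all_algebra.
From mathcomp Require Import zify.
Import Order.TTheory GRing.Theory Num.Theory.

Set Implicit Arguments. Unset Strict Implicit. Unset Printing Implicit Defensive.

(* Residual capacities between disjoint vertex sets are determined by cut queries
   and by the known flow, so a residual edge between two sets is found by bisection
   with O(log n) queries; no randomness is needed.  With labels capped at
   D ~ n^(2/3), a push-relabel algorithm moving one unit of excess at a time
   makes O(n D) pushes and relabels.  When it stops, the level sets of the labels
   (Karger-Levine) include an s-t cut of residual capacity O((n / D)^2) = O(D), so
   O(D) further augmentations suffice, each found by one graph search with
   O(n log n) queries.  Only preflows occur: excess abandoned inside the graph does
   not affect the bound of the excess at t by every s-t cut. *)

(** * Coin-free query algorithms with certified query counts *)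

Fixpoint qbind {n : nat} {A B : Type} (a : qalg n A) (f : A -> qalg n B) : qalg n B :=
  match a with
  | QRet x => f x
  | QQuery Q k => QQuery Q (fun m => qbind (k m) f)
  | QFlip k => QFlip (fun b => qbind (k b) f)
  end.

(* The coin-free algorithm [a] makes at most [q] queries to the oracle [c] and
   its result satisfies [P]. *)
Fixpoint qspec {n : nat} {A : Type} (c : {set 'I_n} -> nat) (a : qalg n A)
    (q : nat) (P : A -> Prop) : Prop :=
  match a with
  | QRet x => P x
  | QQuery Q k => if q is q'.+1 then qspec c (k (c Q)) q' P else False
  | QFlip _ => False
  end.

Lemma qspec_weaken (n : nat) (A : Type) (c : {set 'I_n} -> nat) (a : qalg n A)
    (q q' : nat) (P P' : A -> Prop) :
  qspec c a q P -> q <= q' -> (forall x, P x -> P' x) -> qspec c a q' P'.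
Proof.
elim: a q q' => [x|Q k IH|k IH] q q' //=; first by move=> Px _; apply.
by case: q q' => [|q] [|q'] //= H le_q HP; apply: IH H _ HP.
Qed.

Lemma qspec_bind (n : nat) (A B : Type) (c : {set 'I_n} -> nat) (a : qalg n A)
    (f : A -> qalg n B) (q1 q2 : nat) (P : A -> Prop) (Q : B -> Prop) :
  qspec c a q1 P -> (forall x, P x -> qspec c (f x) q2 Q) ->
  qspec c (qbind a f) (q1 + q2) Q.
Proof.
elim: a q1 => [x|S k IH|k IH] q1 //=.
  by move=> Px /(_ _ Px) H; apply: qspec_weaken H (leq_addl _ _) _.
by case: q1 => [|q1] //= H Hf; apply: IH.
Qed.

Lemma qspec_nqueries (n : nat) (A : Type) (c : {set 'I_n} -> nat) (a : qalg n A)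
    (q : nat) (P : A -> Prop) : qspec c a q P -> nqueries c a <= q.
Proof. by elim: a q => [x|Q k IH|k IH] [|q] //= /IH. Qed.

Lemma qspec_succ_prob (n : nat) (A : Type) (c : {set 'I_n} -> nat) (a : qalg n A)
    (q : nat) (P : pred A) : qspec c a q P -> succ_prob c P a = 1%R.
Proof. by elim: a q => [x|Q k IH|k IH] [|q] //=; try (by move=> ->); move/IH. Qed.

Fixpoint qiter {n : nat} {T : Type} (m : nat) (step : T -> qalg n T) (x : T) : qalg n T :=
  if m is m'.+1 then qbind (step x) (qiter m' step) else QRet x.

(** Rule for loops with a fixed number of rounds: the hypothesis makes [fin] absorbing, and before
    it is reached [phi] falls in every round, so [m] rounds suffice. *)
Lemma qspec_iter (n : nat) (T : Type) (c : {set 'I_n} -> nat) (step : T -> qalg n T)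
    (q : nat) (Inv : T -> Prop) (fin : pred T) (phi : T -> nat) :
  (forall x, Inv x ->
     qspec c (step x) q (fun y => Inv y /\ (fin y \/ ~~ fin x /\ phi y < phi x))) ->
  forall m x, Inv x -> fin x \/ phi x < m ->
    qspec c (qiter m step x) (m * q) (fun y => Inv y /\ fin y).
Proof.
move=> Hstep; elim=> [|m IH] x Ix /=; first by case.
move=> Hx; rewrite mulSn; apply: qspec_bind (Hstep x Ix) _ => y [Iy Hy].
apply: IH => //; case: Hy => [|[nfx lt_yx]]; first by left.
by right; case: Hx => [fx|lt_xm]; [rewrite fx in nfx | lia].
Qed.

(** * Edge counts between disjoint sets from cut queries *)

Definition edge_count {n : nat} (e : rel 'I_n) (A B : {set 'I_n}) : nat :=
  \sum_(u in A) \sum_(v in B) e u v.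

Lemma cut_valueE (n : nat) (e : rel 'I_n) (S : {set 'I_n}) :
  cut_value e S = edge_count e S (~: S).
Proof.
rewrite /cut_value /edge_count cardsE -sum1_card pair_big /=.
rewrite big_mkcond [RHS]big_mkcond /=; apply: eq_bigr => -[u v] _ /=.
by rewrite unfold_in /= inE; case: (e u v); case: (u \in S); case: (v \in S).
Qed.

Lemma edge_countC (n : nat) (e : rel 'I_n) (A B : {set 'I_n}) :
  symmetric e -> edge_count e A B = edge_count e B A.
Proof.
move=> e_sym; rewrite /edge_count exchange_big /=.
by apply: eq_bigr => u _; apply: eq_bigr => v _; rewrite e_sym.
Qed.

Lemma edge_countUl (n : nat) (e : rel 'I_n) (A A' B : {set 'I_n}) :
  [disjoint A & A'] -> edge_count e (A :|: A') B = edge_count e A B + edge_count e A' B.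
Proof.
move=> dis; rewrite /edge_count -bigU //=.
by apply: eq_bigl => u; rewrite !inE.
Qed.

Lemma edge_countUr (n : nat) (e : rel 'I_n) (A B B' : {set 'I_n}) :
  [disjoint B & B'] -> edge_count e A (B :|: B') = edge_count e A B + edge_count e A B'.
Proof.
move=> dis; rewrite /edge_count -big_split /=.
apply: eq_bigr => u _; rewrite -bigU //=.
by apply: eq_bigl => v; rewrite !inE.
Qed.

(** On the left an edge between [A] and [B] counts twice, in the cut of the union not at all; every
    other edge counts equally on both sides. *)
Lemma cut_value_edge_count (n : nat) (e : rel 'I_n) (A B : {set 'I_n}) :
  symmetric e -> [disjoint A & B] ->
  cut_value e A + cut_value e B = cut_value e (A :|: B) + (edge_count e A B).*2.
Proof.
move=> e_sym disAB; rewrite !cut_valueE.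
have disC : forall X Y : {set 'I_n}, X \subset Y -> [disjoint X & ~: Y].
  by move=> X Y sXY; rewrite disjoints_subset setCK.
have -> : ~: A = B :|: ~: (A :|: B).
  apply/setP=> x; move/setDidPl/setP/(_ x): disAB.
  by rewrite !inE; case: (x \in A); case: (x \in B).
have -> : ~: B = A :|: ~: (A :|: B).
  apply/setP=> x; move/setDidPl/setP/(_ x): disAB.
  by rewrite !inE; case: (x \in A); case: (x \in B).
rewrite !edge_countUr ?disC ?subsetUl ?subsetUr // edge_countUl //.
rewrite (edge_countC B A) //; lia.
Qed.

Definition edge_count_query {n : nat} (A B : {set 'I_n}) : qalg n nat :=
  QQuery A (fun a => QQuery B (fun b => QQuery (A :|: B) (fun c =>
    QRet ((a + b - c)./2)))).

Lemma edge_count_query_spec (n : nat) (e : rel 'I_n) (A B : {set 'I_n}) :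
  symmetric e -> [disjoint A & B] ->
  qspec (cut_value e) (edge_count_query A B) 3 (fun k => k = edge_count e A B).
Proof.
by move=> e_sym dis /=; rewrite cut_value_edge_count // addKn doubleK.
Qed.

(** * Flows and residual capacities *)

Local Open Scope ring_scope.

Definition flow (n : nat) : Type := 'I_n -> 'I_n -> int.

Definition excess {n : nat} (f : flow n) (v : 'I_n) : int := \sum_u f u v.

Definition feasible {n : nat} (e : rel 'I_n) (f : flow n) : Prop :=
  (forall u v, f u v = - f v u) /\ (forall u v, f u v <= (e u v)%:Z).

Definition preflow {n : nat} (e : rel 'I_n) (s : 'I_n) (f : flow n) : Prop :=
  feasible e f /\ (forall v, v != s -> 0 <= excess f v).

Definition residual {n : nat} (e : rel 'I_n) (f : flow n) (u v : 'I_n) : int :=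
  (e u v)%:Z - f u v.

Definition push {n : nat} (f : flow n) (u v : 'I_n) : flow n := fun x y =>
  f x y + ((x == u) && (y == v))%:Z - ((x == v) && (y == u))%:Z.

Lemma sum_eq_and (n : nat) (u : 'I_n) (b : bool) :
  \sum_(x : 'I_n) ((x == u) && b)%:Z = b%:Z.
Proof.
by rewrite (bigD1 u) //= eqxx big1 ?addr0 // => x /negPf ->.
Qed.

Lemma excess_push (n : nat) (f : flow n) (u v w : 'I_n) :
  excess (push f u v) w = excess f w + (w == v)%:Z - (w == u)%:Z.
Proof. by rewrite /excess /push !big_split /= sumrN !sum_eq_and. Qed.

Lemma push_feasible (n : nat) (e : rel 'I_n) (f : flow n) (u v : 'I_n) :
  feasible e f -> 0 < residual e f u v -> feasible e (push f u v).
Proof.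
rewrite /residual => -[f_anti f_cap] res_gt0; split=> x y; rewrite /push.
  by rewrite (f_anti x y) [(y == v) && _]andbC [(y == u) && _]andbC; lia.
have := f_cap x y; case: (altP (x =P u)) => [->|_]; case: (altP (y =P v)) => [->|_] /=; lia.
Qed.

Lemma residual_ge0 (n : nat) (e : rel 'I_n) (f : flow n) (u v : 'I_n) :
  feasible e f -> 0 <= residual e f u v.
Proof. by case=> _ /(_ u v); rewrite /residual; lia. Qed.

(** One unit comes from the edge itself, a second from cancelling flow in the opposite direction. *)
Lemma residual_le2 (n : nat) (e : rel 'I_n) (f : flow n) (u v : 'I_n) :
  feasible e f -> residual e f u v <= 2.
Proof. by case=> anti /(_ v u); rewrite /residual (anti u v); lia. Qed.

Definition flow_across {n : nat} (f : flow n) (A B : {set 'I_n}) : int :=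
  \sum_(u in A) \sum_(v in B) f u v.

(** Since [f] is known to the algorithm, this turns an edge count into the total residual capacity
    from [A] to [B]. *)
Lemma edge_count_flow_across (n : nat) (e : rel 'I_n) (f : flow n) (A B : {set 'I_n}) :
  (edge_count e A B)%:Z = flow_across f A B + \sum_(u in A) \sum_(v in B) residual e f u v.
Proof.
rewrite /edge_count /flow_across -big_split /= -natz.
rewrite natr_sum; apply: eq_bigr => u _.
rewrite natr_sum -big_split /=; apply: eq_bigr => v _.
by rewrite /residual addrC subrK natz.
Qed.

Lemma excess_sum (n : nat) (f : flow n) (T : {set 'I_n}) :
  (forall u v, f u v = - f v u) ->
  \sum_(v in T) excess f v = flow_across f (~: T) T.
Proof.
move=> anti; rewrite /excess exchange_big /= (bigID (mem T)) /=.
have -> : \sum_(u in T) \sum_(v in T) f u v = 0.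
  set x := LHS; suff : x = - x by lia.
  rewrite {1}/x exchange_big /= /x -sumrN; apply: eq_bigr => u _.
  by rewrite -sumrN; apply: eq_bigr => v _; rewrite anti.
by rewrite add0r; apply: eq_bigl => u; rewrite inE.
Qed.

(** Weak duality for preflows: the excesses outside [S] sum to the flow leaving [S], and those other
    than at [t] are nonnegative. *)
Lemma excess_sink_le_cut (n : nat) (e : rel 'I_n) (s t : 'I_n) (f : flow n)
    (S : {set 'I_n}) :
  preflow e s f -> s \in S -> t \notin S -> excess f t <= (cut_value e S)%:Z.
Proof.
move=> [ff ex_ge0] sS tS; rewrite cut_valueE (edge_count_flow_across e f).
have := excess_sum (~: S) ff.1; rewrite setCK => <-.
rewrite (bigD1 t) ?inE //= -addrA lerDl addr_ge0 //.
  apply: sumr_ge0 => v /andP[]; rewrite inE => vS _; apply: ex_ge0.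
  by apply: contraNneq vS => ->.
by do 2![apply: sumr_ge0 => ? _]; apply: residual_ge0.
Qed.

Lemma cut_excess_sink (n : nat) (e : rel 'I_n) (t : 'I_n) (f : flow n) (S : {set 'I_n}) :
  feasible e f -> t \notin S ->
  (forall v, v \notin S -> v != t -> excess f v = 0) ->
  (cut_value e S)%:Z = excess f t + \sum_(u in S) \sum_(v in ~: S) residual e f u v.
Proof.
move=> ff tS ex0; rewrite cut_valueE (edge_count_flow_across e f); congr (_ + _).
have := excess_sum (~: S) ff.1; rewrite setCK => <-.
rewrite (bigD1 t) ?inE //= big1 ?addr0 // => v /andP[]; rewrite inE.
exact: ex0.
Qed.

Fixpoint augment {n : nat} (f : flow n) (x : 'I_n) (p : seq 'I_n) : flow n :=
  if p is y :: p' then push (augment f y p') x y else f.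

(** Edges are pushed from the far end back. On a simple path the later pushes leave the row of [x]
    untouched, so the edge from [x] keeps its residual capacity; the third conclusion carries this
    through the induction. *)
Lemma augment_spec (n : nat) (e : rel 'I_n) (f : flow n) (x : 'I_n) (p : seq 'I_n) :
  feasible e f -> path (fun a b => 0 < residual e f a b) x p -> uniq (x :: p) ->
  [/\ feasible e (augment f x p),
      forall w, excess (augment f x p) w
                = excess f w + (w == last x p)%:Z - (w == x)%:Z
    & forall a b, a \notin x :: p -> augment f x p a b = f a b].
Proof.
move=> ff; elim: p x => [|y p IH] x /=; first by split=> // w; lia.
case/andP=> res_xy yp /andP[x_yp u_yp].
have [af ae au] := IH y yp u_yp; split.
- by apply: push_feasible => //; rewrite /residual au.
- by move=> w; rewrite excess_push ae; lia.
- move=> a b; rewrite in_cons negb_or => /andP[ax ayp].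
  rewrite /push au //; rewrite in_cons negb_or in ayp; case/andP: ayp => ay _.
  by rewrite (negPf ax) (negPf ay) /=; lia.
Qed.

Local Close Scope ring_scope.

(** * Locating a residual edge by bisection *)

Definition residual_query {n : nat} (f : flow n) (A B : {set 'I_n}) : qalg n bool :=
  qbind (edge_count_query A B) (fun k => QRet (flow_across f A B < k%:Z)%R).

(** Residual capacities are nonnegative, so their sum is positive exactly when one of them is. *)
Lemma residual_query_spec (n : nat) (e : rel 'I_n) (f : flow n) (A B : {set 'I_n}) :
  symmetric e -> feasible e f -> [disjoint A & B] ->
  qspec (cut_value e) (residual_query f A B) 3
    (fun b => b = [exists u in A, exists v in B, 0 < residual e f u v]%R).
Proof.
move=> e_sym ff dis; rewrite -(addn0 3).
apply: qspec_bind (edge_count_query_spec e_sym dis) _ => k -> /=.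
have r0 := residual_ge0 _ _ ff.
rewrite (edge_count_flow_across e f) ltrDl lt0r sumr_ge0 ?andbT; last first.
  by move=> u _; apply: sumr_ge0.
apply/idP/exists_inP.
  rewrite psumr_neq0 => [/hasP[u _ /andP[uA]]|u _]; last exact: sumr_ge0.
  rewrite lt0r sumr_ge0 ?andbT // psumr_neq0 // => /hasP[v _ vB].
  by exists u => //; apply/exists_inP; exists v; case/andP: vB.
case=> u uA /exists_inP[v vB ruv]; rewrite psumr_neq0 => [|w _]; last exact: sumr_ge0.
apply/hasP; exists u; rewrite ?mem_index_enum // uA /=.
rewrite lt0r sumr_ge0 ?andbT // psumr_neq0 //.
by apply/hasP; exists v; rewrite ?mem_index_enum ?vB.
Qed.

Fixpoint bisect {n : nat} {T : Type} (m : nat) (test : seq T -> qalg n bool) (X : seq T) :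
    qalg n (option T) :=
  if m is m'.+1 then
    qbind (test (take (size X)./2 X)) (fun b =>
      bisect m' test (if b then take (size X)./2 X else drop (size X)./2 X))
  else QRet (ohead X).

(** Only the first half is tested: if it holds no witness, the second half does. A singleton has an
    empty first half and survives surplus rounds unchanged. *)
Lemma bisect_spec (n : nat) (T : eqType) (c : {set 'I_n} -> nat) (A : pred T) (P : pred T)
    (test : seq T -> qalg n bool) (q : nat) :
  (forall X, {subset X <= A} -> qspec c (test X) q (fun b => b = has P X)) ->
  forall m X, {subset X <= A} -> has P X -> size X <= 2 ^ m ->
    qspec c (bisect m test X) (m * q) (fun o => exists2 x, o = Some x & (x \in A) && P x).
Proof.
move=> Htest; elim=> [|m IH] X sXA hX szX /=.
  case: X sXA hX szX => [|x [|y X]] //= sXA; rewrite orbF => Px _.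
  by exists x => //; rewrite Px sXA ?mem_head.
rewrite mulSn; set h := (size X)./2.
have sT : {subset take h X <= A} by move=> x /mem_take /sXA.
have sD : {subset drop h X <= A} by move=> x /mem_drop /sXA.
apply: qspec_bind (Htest _ sT) _ => b ->.
have eX : has P X = has P (take h X) || has P (drop h X) by rewrite -has_cat cat_take_drop.
have h_le : h <= 2 ^ m /\ size X - h <= 2 ^ m by rewrite /h expnS in szX *; lia.
case: ifP => hT; apply: IH => //; rewrite ?size_drop; try lia.
by rewrite size_take; case: ifP; lia.
Qed.

Definition depth (n : nat) : nat := (trunc_log 2 n).+1.

Lemma depthP (n : nat) (A : {set 'I_n}) : size (enum A) <= 2 ^ depth n.
Proof.
rewrite -cardE; apply: leq_trans (max_card _) _; rewrite card_ord ltnW //.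
exact: trunc_log_ltn.
Qed.

Definition find_edge {n : nat} (f : flow n) (A B : {set 'I_n}) :
    qalg n (option ('I_n * 'I_n)) :=
  qbind (residual_query f A B) (fun b =>
    if b then
      qbind (bisect (depth n) (fun X => residual_query f [set x in X] B) (enum A)) (fun o =>
        if o is Some u then
          qbind (bisect (depth n) (fun X => residual_query f [set u] [set x in X]) (enum B))
            (fun o' => QRet (omap (pair u) o'))
        else QRet None)
    else QRet None).

Lemma find_edge_spec (n : nat) (e : rel 'I_n) (f : flow n) (A B : {set 'I_n}) :
  symmetric e -> feasible e f -> [disjoint A & B] ->
  qspec (cut_value e) (find_edge f A B) (9 * depth n)
    (fun o => if o is Some (u, v) then [/\ u \in A, v \in B & (0 < residual e f u v)%R]
              else forall u v, u \in A -> v \in B -> residual e f u v = 0%R).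
Proof.
move=> e_sym ff dis; set L := depth n.
(* One existence test, then one bisection for the tail and one for the head, at three queries per
   test; [L] is at least 1. *)
have le_q : 3 + (L * 3 + (L * 3 + 0)) <= 9 * L by rewrite /L /depth; lia.
apply: (fun H => qspec_weaken H le_q (fun _ => id)).
apply: qspec_bind (residual_query_spec e_sym ff dis) _ => b ->.
case: ifPn => [/exists_inP[u0 u0A ru0]|nex]; last first.
  move=> u v uA vB; apply/eqP; rewrite eq_le residual_ge0 // andbT leNgt.
  by apply: contra nex => ruv; apply/exists_inP; exists u => //; apply/exists_inP; exists v.
pose P u := [exists v in B, 0 < residual e f u v]%R.
apply: (@qspec_bind _ _ _ _ _ _ _ _ (fun o => exists2 x, o = Some x & (x \in mem A) && P x)).
  apply: bisect_spec (depthP A).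
  - move=> X sXA; have disX : [disjoint [set x in X] & B].
      apply/pred0P => x /=; rewrite inE; apply/negP => /andP[/sXA xA xB].
      by have /pred0P/(_ x) := dis; rewrite /= xB xA.
    apply: (qspec_weaken (residual_query_spec e_sym ff disX) (leqnn 3)) => b' ->.
    by apply/exists_inP/hasP => -[u uX Pu]; exists u; rewrite ?inE // in uX *.
  - by move=> x; rewrite mem_enum.
  - by apply/hasP; exists u0; rewrite ?mem_enum.
move=> o [u -> /andP[uA /exists_inP[v0 v0B rv0]]].
apply: (@qspec_bind _ _ _ _ _ _ _ _
         (fun o => exists2 x, o = Some x & (x \in mem B) && (0 < residual e f u x)%R)).
  apply: bisect_spec (depthP B).
  - move=> X sXB; have disX : [disjoint [set u] & [set x in X]].
      apply/pred0P => x /=; rewrite !inE; apply/negP => /andP[/eqP-> /sXB uB].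
      by have /pred0P/(_ u) := dis; rewrite /= uB uA.
    apply: (qspec_weaken (residual_query_spec e_sym ff disX) (leqnn 3)) => b' ->.
    apply/exists_inP/hasP.
      by case=> x /set1P-> /exists_inP[v]; rewrite inE => vX rv; exists v.
    case=> v vX rv; exists u; rewrite ?set11 //; apply/exists_inP.
    by exists v; rewrite ?inE.
  - by move=> x; rewrite mem_enum.
  - by apply/hasP; exists v0; rewrite ?mem_enum.
by move=> o' [v -> /andP[vB rv]].
Qed.

(** * Push-relabel with a single unit of excess in motion *)

(* One unit of excess, the token, moves at a time.  A token at a vertex of label
   [D] is abandoned there.  [pr_rem] lists the vertices [v] for which the edge
   [s v] has not yet been probed and saturated. *)
Record pr_state (n : nat) := PrState {
  pr_flow : flow n;
  pr_label : 'I_n -> nat;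
  pr_token : option 'I_n;
  pr_rem : seq 'I_n }.

Definition pr_step {n : nat} (s t : 'I_n) (D : nat) (x : pr_state n) : qalg n (pr_state n) :=
  let: PrState f d tok rem := x in
  match tok, rem with
  | Some u, _ =>
      if (u == t) || (d u == D) then QRet (PrState f d None rem)
      else qbind (find_edge f [set u] [set v | (d v).+1 == d u]) (fun o =>
        if o is Some (_, v) then QRet (PrState (push f u v) d (Some v) rem)
        else QRet (PrState f (fun w => d w + (w == u)) (Some u) rem))
  | None, v :: rem' =>
      qbind (find_edge f [set s] [set v]) (fun o =>
        if o is Some _ then QRet (PrState (push f s v) d (Some v) rem')
        else QRet (PrState f d None rem'))
  | None, [::] => QRet x
  end.

Definition pr_done {n : nat} (x : pr_state n) : bool :=
  ~~ isSome (pr_token x) && nilp (pr_rem x).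

(** Abandoned excess sits at label [D], hence the restriction in [pr_excess]. [pr_flow_s] ensures
    that once [pr_rem] is empty no residual edge leaves [s], the one vertex exempt from
    [pr_label_valid]. *)
Record pr_inv {n : nat} (e : rel 'I_n) (s t : 'I_n) (D : nat) (x : pr_state n) : Prop := PrInv {
  pr_preflow : preflow e s (pr_flow x);
  pr_label_s : pr_label x s = D;
  pr_label_t : pr_label x t = 0;
  pr_label_le : forall v, pr_label x v <= D;
  pr_label_valid : forall u v, u != s -> (0 < residual e (pr_flow x) u v)%R ->
    pr_label x u <= (pr_label x v).+1;
  pr_excess : forall v, v != t -> pr_label x v < D ->
    excess (pr_flow x) v = (pr_token x == Some v)%:Z%R;
  pr_token_s : pr_token x != Some s;
  pr_rem_uniq : uniq (pr_rem x);
  pr_rem_s : s \notin pr_rem x;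
  pr_flow_s : forall v, pr_flow x s v = if v \in pr_rem x then 0%R else (e s v)%:Z%R }.

(** A relabel lowers the doubled sum by 2 and raises the token term by 1; a push lowers the token
    term by 1; abandoning the token removes its term. Launching a token frees [D.+2] and costs at
    most [D.+1]. *)
Definition pr_potential {n : nat} (D : nat) (x : pr_state n) : nat :=
  (\sum_v (D - pr_label x v)).*2 + (if pr_token x is Some u then (pr_label x u).+1 else 0)
  + D.+2 * size (pr_rem x).

Lemma pr_step_spec (n : nat) (e : rel 'I_n) (s t : 'I_n) (D : nat) (x : pr_state n) :
  symmetric e -> s != t -> pr_inv e s t D x ->
  qspec (cut_value e) (pr_step s t D x) (9 * depth n)
    (fun y => pr_inv e s t D y /\
       (pr_done y \/ ~~ pr_done x /\ pr_potential D y < pr_potential D x)).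
Proof.
move=> e_sym st; case: x => f d [u|] rem [/= [ff ex0] ds dt dle dval ex tok_s rem_u rem_s fs].
  have us : u != s by apply: contraNneq tok_s => ->.
  case: ifPn => [u_stop|].
    split; last by right; split => //; rewrite /pr_potential /= ltn_add2r addn0 -addn1 leq_add2l.
    (* The token stopped at [t] or at label [D], both outside the scope of [pr_excess]. *)
    split=> //= v vt dv; rewrite ex //; case: eqP => // -[uv].
    by move: u_stop; rewrite uv (negPf vt) /= ltn_eqF.
  rewrite negb_or => /andP[ut duD].
  have du_lt : d u < D by rewrite ltn_neqAle duD dle.
  have dis : [disjoint [set u] & [set v | (d v).+1 == d u]].
    by rewrite disjoints1 inE gtn_eqF.
  rewrite -(addn0 (9 * _)); apply: qspec_bind (find_edge_spec e_sym ff dis) _.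
  case=> [[u' v] [/set1P->]|no_adm] /=.
    rewrite inE => /eqP dv res_uv.
    have vs : v != s.
      by apply: contraTneq du_lt => v_s; rewrite -dv v_s ds -leqNgt leqnSn.
    have exu : excess f u = 1%R by rewrite ex // eqxx.
    split.
      split=> //=.
      - split; first exact: push_feasible.
        move=> w ws; rewrite excess_push; have := ex0 w ws.
        case: (altP (w =P u)) => [->|_]; rewrite ?exu.
          by case: (u == v).
        by rewrite subr0 => ?; rewrite addr_ge0.
      - move=> a b a_s; rewrite /residual /push => res_ab.
        (* The only residual edge a push can create is the reverse one, which goes up one label. *)
        case: (boolP ((a == v) && (b == u))) => [/andP[/eqP-> /eqP->]|ab].
          by rewrite -dv ltnW // ltnW.
        apply: dval => //; move: res_ab; rewrite (negPf ab) /residual.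
        by move: (e a b) (f a b) ((a == u) && _); clear; lia.
      - move=> w wt dw; rewrite excess_push ex // !(inj_eq Some_inj).
        by rewrite (eq_sym u) (eq_sym v); move: (w == u) (w == v); clear; lia.
      - by move=> w; rewrite /push fs ![s == _]eq_sym (negPf us) (negPf vs) /= addr0 subr0.
    right; split => //; rewrite /pr_potential /= -dv; move: (\sum_v _) (D.+2 * _) => A B.
    by clear; lia.
  have lab_u : forall w, w != u -> d w + (w == u) = d w by move=> w /negPf->; rewrite addn0.
  split; last first.
    right; split => //; rewrite /pr_potential /= eqxx.
    rewrite (bigD1 u) //= (eq_bigr (fun v => D - d v)) => [|w wu]; last by rewrite lab_u.
    rewrite [\sum_v (D - d v)](bigD1 u) //= eqxx.
    by move: (\sum_(v | _) _) (D.+2 * _) (d u) du_lt; clear; lia.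
  split=> //=.
  - by rewrite lab_u // eq_sym.
  - by rewrite lab_u // eq_sym.
  - by move=> w; case: (altP (w =P u)) => [->|_]; rewrite ?addn0 ?addn1.
  - move=> a b a_s res_ab; have := dval a b a_s res_ab.
    case: (altP (a =P u)) => [eau|_] d_ab; last first.
      by rewrite addn0 (leq_trans d_ab) // ltnS leq_addr.
    (* A residual edge from [u] that the relabel would invalidate drops by exactly one label, and
       the failed search excludes such edges. *)
    rewrite addn1 ltnS (leq_trans _ (leq_addr _ _)) // leqNgt; apply/negP => lt_ba.
    have eq_ba : (d b).+1 == d a by rewrite eqn_leq lt_ba d_ab.
    have := no_adm u b (set11 u); rewrite inE -eau eq_ba => /(_ isT) res0.
    by rewrite res0 ltxx in res_ab.
  - by move=> w wt dw; apply: ex => //; apply: leq_ltn_trans dw; apply: leq_addr.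
case: rem rem_u rem_s fs => [|v rem].
  by move=> _ _ fs; split; [split | left].
rewrite cons_uniq => /andP[v_rem rem_u]; rewrite in_cons negb_or => /andP[sv rem_s] fs.
have dis : [disjoint [set s] & [set v]] by rewrite disjoints1 inE.
have fsv : f s v = 0%R by rewrite fs mem_head.
rewrite -(addn0 (9 * _)); apply: qspec_bind (find_edge_spec e_sym ff dis) _.
case=> [[s' v'] [/set1P-> /set1P-> res_sv]|no_adm] /=.
  have esv : e s v by move: res_sv; rewrite /residual fsv; case: (e s v).
  split; last first.
    right; split => //; rewrite /pr_potential /= mulnS.
    by move: (\sum_v _) (D.+2 * size _) (d v) (dle v); clear; lia.
  split=> //=.
  - split; first exact: push_feasible.
    by move=> w ws; rewrite excess_push (negPf ws) subr0 addr_ge0 ?ex0.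
  - move=> a b a_s; rewrite /residual /push (negPf a_s) /= addr0 => res_ab.
    (* Edges made residual here end in [s], whose label [D] is maximal. *)
    case: (altP (b =P s)) => [->|bs]; first by rewrite ds ltnW // ltnS.
    by apply: dval => //; move: res_ab; rewrite (negPf bs) andbF subr0.
  - move=> w wt dw; have ws : w != s by apply: contraTneq dw => ->; rewrite ds ltnn.
    by rewrite excess_push ex // (negPf ws) /= add0r subr0 (inj_eq Some_inj) eq_sym.
  - by apply: contraNneq sv => -[->].
  - move=> w; rewrite /push fs eqxx in_cons (negPf sv) /= subr0.
    by case: (altP (w =P v)) => [->|_] /=; rewrite ?(negPf v_rem) ?esv // addr0.
split.
  split=> //= w; rewrite fs in_cons; case: (altP (w =P v)) => [->|_] //=.
  (* Zero residual capacity under zero flow means that [s v] is not an edge, so it counts as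
     saturated. *)
  have := no_adm s v (set11 s) (set11 v); rewrite /residual fsv subr0 (negPf v_rem).
  by move=> ->.
by right; split => //; rewrite /pr_potential /= ltn_add2l ltn_pmul2l.
Qed.

Definition pr_init {n : nat} (s : 'I_n) (D : nat) : pr_state n :=
  PrState (fun _ _ => 0%R) (fun v => if v == s then D else 0) None (rem s (enum 'I_n)).

Lemma pr_init_inv (n : nat) (e : rel 'I_n) (s t : 'I_n) (D : nat) :
  irreflexive e -> s != t -> pr_inv e s t D (pr_init s D).
Proof.
move=> e_irr st; have ex0 v : excess (fun _ _ : 'I_n => 0%R) v = 0%R by apply: big1.
split=> //=.
- by split=> [|v _]; rewrite ?ex0 //; split=> u v; rewrite ?oppr0 //; case: (e u v).
- by rewrite eqxx.
- by rewrite eq_sym (negPf st).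
- by move=> v; case: ifP.
- by move=> u v /negPf->.
- by rewrite rem_uniq ?enum_uniq.
- by rewrite mem_rem_uniq ?enum_uniq // !inE eqxx.
- move=> v; rewrite mem_rem_uniq ?enum_uniq // !inE mem_enum andbT.
  by case: (altP (v =P s)) => [->|] //=; rewrite e_irr.
Qed.

Lemma pr_init_potential (n : nat) (s : 'I_n) (D : nat) :
  0 < D -> pr_potential D (pr_init s D) < 5 * n * D.
Proof.
move=> D_gt0; have n_gt0 : 0 < n by apply: leq_ltn_trans (ltn_ord s).
rewrite /pr_potential /= addn0 size_rem ?mem_enum // size_enum_ord.
have : \sum_(v : 'I_n) (D - (if v == s then D else 0)) <= n * D.
  by apply: leq_trans (leq_sum _ (fun v _ => leq_subr _ D)) _; rewrite sum_nat_const card_ord.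
(* With the doubled label sum, at most [2 * (n * D)], this gives the factor 5. *)
have : D.+2 * n.-1 < 3 * (n * D).
  by rewrite -(prednK n_gt0) /=; move: n.-1 D_gt0; clear; nia.
by rewrite -mulnA; move: (\sum_v _) (n * D) (D.+2 * n.-1); clear; lia.
Qed.

(** Averaging: over all [i < D] each vertex is counted at most once in either family of levels, so
    the [D] sums total at most [2 * n]. *)
Lemma sparse_level (n D : nat) (d : 'I_n -> nat) :
  0 < D -> exists2 i, i < D &
    D * (#|[set v | d v == i.+1]| + #|[set v | d v == i]|) <= 2 * n.
Proof.
move=> D_gt0.
have level_sum (g : nat -> nat) : injective g -> \sum_(i < D) #|[set v | d v == g i]| <= n.
  move=> g_inj; rewrite (eq_bigr (fun i : 'I_D => \sum_(v : 'I_n) (d v == g i))).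
    2: by move=> i _; rewrite -sum1_card big_mkcond; apply: eq_bigr => v _; rewrite inE.
  rewrite exchange_big -[leqRHS]card_ord -sum1_card; apply: leq_sum => v _ /=.
  rewrite -big_mkcond sum1dep_card.
  apply/card_le1_eqP => i j; rewrite !inE => /eqP dvi /eqP dvj.
  by apply/val_inj/g_inj; rewrite -dvi dvj.
case: (pickP (fun i : 'I_D => D * (#|[set v | d v == i.+1]| + #|[set v | d v == i :> nat]|)
                               <= 2 * n)) => [i le_i|none]; first by exists (i : nat).
have := leq_add (level_sum succn succn_inj) (level_sum id (@inj_id _)).
rewrite -big_split /= => le_sum.
have : \sum_(i < D) (2 * n).+1 <= \sum_(i < D)
    D * (#|[set v | d v == i.+1]| + #|[set v | d v == i :> nat]|).
  by apply: leq_sum => i _; rewrite ltnNge none.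
rewrite -big_distrr /= sum_nat_const card_ord leq_pmul2l //; lia.
Qed.

(* A residual edge leaving a level set drops by exactly one level, so some level
   set is crossed by at most [2 (n / D) ^ 2 <= 2 D] units of residual capacity. *)
Lemma pr_done_cut (n : nat) (e : rel 'I_n) (s t : 'I_n) (D : nat) (x : pr_state n) :
  0 < D -> n ^ 2 <= D ^ 3 -> pr_inv e s t D x -> pr_done x ->
  exists S : {set 'I_n}, [/\ s \in S, t \notin S &
    ((cut_value e S)%:Z <= excess (pr_flow x) t + (2 * D)%:Z)%R].
Proof.
case: x => f d [u|] [|v rem] // D_gt0 nD [/= [ff ex0] ds dt dle dval ex _ _ _ fs] _.
have [i i_lt le_i] := sparse_level d D_gt0.
exists [set v | i < d v]; rewrite !inE ds dt; split=> //.
rewrite (@cut_excess_sink _ _ t f) // ?inE ?dt //; last first.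
  by move=> v; rewrite inE => dv vt; rewrite ex //; lia.
rewrite lerD2l.
set a := #|_| in le_i; set b := #|_| in le_i.
(* By the AM-GM inequality, [4ab] is at most [(a + b)^2], and [D^2 (a + b)^2] is at most [4n^2],
   hence at most [4D^3]. *)
have ab_le : a * b <= D.
  have : 4 * (a * b) <= (a + b) ^ 2 by apply: (nat_AGM2 a b).1.
  have : (D * (a + b)) ^ 2 <= (2 * n) ^ 2 by rewrite leq_sqr.
  rewrite !expnMn => h1 h2.
  have h3 : D ^ 2 * (4 * (a * b)) <= D ^ 2 * (4 * D).
    apply: leq_trans (leq_mul (leqnn _) h2) _; apply: leq_trans h1 _.
    by move: nD; rewrite !expnS !expn0; lia.
  by move: h3; rewrite leq_pmul2l ?expn_gt0 ?D_gt0 //; lia.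
have -> : (2 * D)%:Z%R = (2 * D%:Z)%R by [].
apply: (@le_trans _ _ (2 *+ b *+ a)%R); last by rewrite -mulrnA -mulr_natr natz; lia.
rewrite -sumr_const; under [leRHS]eq_bigr do rewrite -sumr_const.
rewrite !pair_big /= big_mkcond [leRHS]big_mkcond /=; apply: ler_sum => -[u v] _ /=.
rewrite !inE; case: ifPn => [/andP[du dv]|_]; last by case: ifP.
(* Outside the pair of levels [i.+1] and [i] the residual capacity vanishes: edges from [s] are
   saturated, and label validity forbids longer drops. *)
case: ifPn => [_|nlev]; first exact: residual_le2.
rewrite leNgt; apply: contra nlev => res_uv.
have us : u != s by apply: contraTneq res_uv => ->; rewrite /residual fs subrr ltxx.
by have := dval u v us res_uv; lia.
Qed.

(** * Completing the preflow by searching backwards from the sink *)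

(* [p v] is a residual path from [v] to [t] for each [v] of the explored set [T].
   The search stops at [s] or at a vertex with positive excess, either of which
   may send one more unit to [t]. *)
Fixpoint grow {n : nat} (s : 'I_n) (m : nat) (f : flow n) (T : {set 'I_n})
    (p : 'I_n -> seq 'I_n) : qalg n (flow n + {set 'I_n}) :=
  if m is m'.+1 then
    qbind (find_edge f (~: T) T) (fun o =>
      if o is Some (u, v) then
        if (u == s) || (0 < excess f u)%R then QRet (inl (augment f u (v :: p v)))
        else grow s m' f (u |: T) (fun w => if w == u then v :: p v else p w)
      else QRet (inr (~: T)))
  else QRet (inr set0).

(** The cut [S] attains the bound of weak duality: its value is the excess at [t], which no other
    cut can undercut. *)
Lemma residual_free_min_cut (n : nat) (e : rel 'I_n) (s t : 'I_n) (f : flow n)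
    (S : {set 'I_n}) :
  preflow e s f -> s \in S -> t \notin S ->
  (forall v, v \notin S -> v != t -> excess f v = 0%R) ->
  (forall u v, u \in S -> v \notin S -> residual e f u v = 0%R) ->
  is_min_st_cut e s t S.
Proof.
move=> pf sS tS ex0 res0; rewrite /is_min_st_cut sS tS /=.
apply/forallP => S'; apply/implyP => sS'; apply/implyP => tS'.
rewrite -lez_nat (cut_excess_sink pf.1 tS ex0) big1 ?addr0.
  exact: (excess_sink_le_cut pf).
by move=> u uS; apply: big1 => v; rewrite inE; apply: res0.
Qed.

(** Each unsuccessful round adds a vertex to [T], so with more fuel than unexplored vertices the
    default [set0] is never returned. Paths stay inside [T], so prepending a vertex from outside
    keeps them simple. *)
Lemma grow_spec (n : nat) (e : rel 'I_n) (s t : 'I_n) (m : nat) (f : flow n)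
    (T : {set 'I_n}) (p : 'I_n -> seq 'I_n) :
  symmetric e -> s != t -> preflow e s f -> t \in T -> s \notin T ->
  (forall v, v \in T -> v != t -> excess f v = 0%R) ->
  (forall v, v \in T -> [/\ path (fun a b => 0 < residual e f a b)%R v (p v),
     last v (p v) = t, uniq (v :: p v) & {subset p v <= T}]) ->
  #|~: T| < m ->
  qspec (cut_value e) (grow s m f T p) (m * (9 * depth n))
    (fun r => match r with
       | inl f' => preflow e s f' /\ excess f' t = (excess f t + 1)%R
       | inr X => is_min_st_cut e s t X
       end).
Proof.
move=> e_sym st pf; elim: m T p => [|m IH] T p tT sT ex0 pP //= m_gt.
have dis : [disjoint ~: T & T] by rewrite disjoint_sym disjoints_subset setCK.
rewrite mulSn; apply: qspec_bind (find_edge_spec e_sym pf.1 dis) _.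
case=> [[u v] [uT vT res_uv]|res0]; last first.
  apply: (residual_free_min_cut pf); rewrite ?inE ?tT //.
    by move=> v; rewrite inE negbK; apply: ex0.
  by move=> u v uT; rewrite inE negbK; apply: res0.
rewrite inE in uT; have [pv lv uv sv] := pP v vT.
have pu : path (fun a b => 0 < residual e f a b)%R u (v :: p v) by rewrite /= res_uv.
have uu : uniq (u :: v :: p v).
  rewrite cons_uniq uv andbT in_cons.
  by apply: contra uT => /orP[/eqP->|/sv].
have ut : u != t by apply: contraNneq uT => ->.
case: ifPn => [u_src|].
  have [af ae _] := augment_spec pf.1 pu uu.
  split; last by rewrite ae /= lv eqxx eq_sym (negPf ut) subr0.
  split=> // w ws; rewrite ae /=; have := pf.2 w ws.
  case: (altP (w =P u)) => [wu|_]; last by rewrite subr0 => ?; rewrite addr_ge0.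
  (* A source other than [s] has positive integral excess and can spare one unit. *)
  move: u_src; rewrite -wu (negPf ws) /= => ex_w _.
  by move: (excess f w) (w == _) ex_w; clear; lia.
rewrite negb_or => /andP[us ex_u]; apply: IH.
- by rewrite in_setU1 tT orbT.
- by rewrite in_setU1 negb_or eq_sym us.
- move=> w; rewrite in_setU1 => /orP[/eqP-> _|wT]; last exact: ex0.
  by apply/eqP; rewrite eq_le pf.2 // andbT leNgt.
- move=> w; rewrite in_setU1; case: (altP (w =P u)) => [->|wu] /= wT.
    split=> // y; rewrite in_cons in_setU1 => /orP[/eqP->|/sv->]; last by rewrite orbT.
    by rewrite vT orbT.
  have [pw lw uw sw] := pP w wT; split=> // y /sw yT.
  by rewrite in_setU1 yT orbT.
- rewrite -ltnS; apply: leq_trans m_gt; rewrite ltnS; apply: proper_card.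
  rewrite properE setCS subsetUr /=; apply/subsetPn; exists u; first by rewrite inE.
  by rewrite !inE eqxx.
Qed.

Fixpoint augment_all {n : nat} (s t : 'I_n) (m : nat) (f : flow n) : qalg n {set 'I_n} :=
  if m is m'.+1 then
    qbind (grow s n f [set t] (fun _ => [::])) (fun r =>
      match r with inl f' => augment_all s t m' f' | inr X => QRet X end)
  else QRet set0.

(** [S] is only a witness for the bound and is unknown to the algorithm. Each augmentation raises
    the excess at [t] by one and weak duality caps it at the value of [S], so the fuel outlasts the
    gap. *)
Lemma augment_all_spec (n : nat) (e : rel 'I_n) (s t : 'I_n) (m : nat) (f : flow n)
    (S : {set 'I_n}) :
  symmetric e -> s != t -> preflow e s f -> s \in S -> t \notin S ->
  ((cut_value e S)%:Z < excess f t + m%:Z)%R ->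
  qspec (cut_value e) (augment_all s t m f) (m * (n * (9 * depth n)))
    (fun S => is_min_st_cut e s t S).
Proof.
move=> e_sym st + sS tS; elim: m f => [|m IH] f pf lt_cut /=.
  by move: lt_cut; rewrite addr0 ltNge (excess_sink_le_cut pf).
have st' : s \notin [set t] by rewrite inE.
rewrite mulSn; apply: (qspec_bind (grow_spec (m := n) e_sym st pf (set11 t) st' _ _ _)).
- by move=> v /set1P->; rewrite eqxx.
- by move=> v /set1P->.
- rewrite cardsC1 card_ord; have : 0 < n by apply: leq_ltn_trans (ltn_ord s).
  by clear; lia.
case=> [f' [pf' ex']|T T_min]; last exact: T_min.
apply: IH => //.
by rewrite ex'; move: lt_cut; move: (excess f t) (cut_value e S); clear; lia.
Qed.

(** * The choice of the label bound *)

Lemma cube_witness (n : nat) : exists D, n ^ 2 <= D ^ 3.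
Proof.
exists (n ^ 2); case: n => // n.
by rewrite -expnM leq_pexp2l.
Qed.

(** The ceiling of [n^(2/3)], free of fractional powers. *)
Definition label_bound (n : nat) : nat := ex_minn (cube_witness n).

Lemma label_boundP (n : nat) : 0 < n ->
  [/\ 0 < label_bound n, n ^ 2 <= label_bound n ^ 3 & label_bound n ^ 3 <= 8 * n ^ 2].
Proof.
move=> n_gt0; rewrite /label_bound; case: ex_minnP => D nD minD.
have D_gt0 : 0 < D.
  by case: D nD {minD} => //; rewrite exp0n // leqn0 expn_eq0 andbT; case: n n_gt0.
split=> //; case: D nD minD D_gt0 => [|[|D]] // nD minD _.
  by rewrite exp1n muln_gt0 expn_gt0 n_gt0.
(* Minimality bounds the predecessor, and [D.+2] is at most twice [D.+1], whence the factor 8. *)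
have lt_D : D.+1 ^ 3 < n ^ 2 by rewrite ltnNge; apply/negP => /minD; rewrite ltnn.
apply: (@leq_trans (8 * D.+1 ^ 3)); last by rewrite leq_mul2l ltnW.
rewrite (_ : 8 = 2 ^ 3) // -expnMn leq_exp2r //; lia.
Qed.

(** * The complete algorithm and its query bound *)

Definition min_cut_alg (n : nat) (s t : 'I_n) : qalg n {set 'I_n} :=
  let D := label_bound n in
  qbind (qiter (5 * n * D) (pr_step s t D) (pr_init s D))
    (fun x => augment_all s t (2 * D).+1 (pr_flow x)).

Lemma min_cut_alg_spec (n : nat) (e : rel 'I_n) (s t : 'I_n) :
  simple_graph e -> s != t ->
  qspec (cut_value e) (min_cut_alg s t) (72 * (n * label_bound n * depth n))
    (is_min_st_cut e s t).
Proof.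
move=> [e_sym e_irr] st; have n_gt0 : 0 < n by apply: leq_ltn_trans (ltn_ord s).
rewrite /min_cut_alg; have [D_gt0 nD _] := label_boundP n_gt0.
move: (label_bound n) D_gt0 nD => D D_gt0 nD.
(* The push-relabel phase contributes 45 and the augmentations 27, since [(2 * D).+1] is at most
   [3 * D]. *)
have le_q : 5 * n * D * (9 * depth n) + (2 * D).+1 * (n * (9 * depth n))
            <= 72 * (n * D * depth n).
  have : (2 * D).+1 * (n * depth n) <= 3 * D * (n * depth n).
    by rewrite leq_mul2r; apply/orP; right; lia.
  by move: (depth n); clear; nia.
apply: (fun H => qspec_weaken H le_q (fun _ => id)).
apply: qspec_bind.
  apply: (qspec_iter (fun x => pr_step_spec (x := x) e_sym st) (pr_init_inv D e_irr st)).
  by right; apply: pr_init_potential.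
move=> x [inv_x done_x]; have [S [sS tS cut_S]] := pr_done_cut D_gt0 nD inv_x done_x.
apply: (augment_all_spec e_sym st (pr_preflow inv_x) sS tS).
by move: (excess _ t) (cut_value e S) cut_S; clear; lia.
Qed.

(** The query bound is cubed to express the exponent 5/3 in natural numbers. *)
Theorem mainTheorem2 :
  exists (alg : forall n : nat, 'I_n -> 'I_n -> qalg n {set 'I_n})
         (C k a b n0 : nat),
    (0 < a)%N /\ (0 < b)%N /\
    forall (n : nat) (e : rel 'I_n) (s t : 'I_n),
      (n0 <= n)%N -> simple_graph e -> s != t ->
      ((nqueries (cut_value e) (alg n s t)) ^ 3
         <= C * n ^ 5 * (trunc_log 2 n).+1 ^ k)%N /\
      (((1 - succ_prob (cut_value e) (is_min_st_cut e s t) (alg n s t)) ^+ b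
         * (n%:R) ^+ a) <= (1 : rat))%R.
Proof.
(* Cubing [72 * (n * D * depth n)] with [D^3] at most [8 * n^2] gives the constant and the log
   exponent 3. The failure probability is zero, so the exponents [a] and [b] can both be 1. *)
exists min_cut_alg, (72 ^ 3 * 8), 3, 1, 1, 1; do 2!split=> //.
move=> n e s t n_gt0 e_simple st; have H := min_cut_alg_spec e_simple st.
split; last by rewrite (qspec_succ_prob H) subrr expr0n mul0r.
have [_ _ le_D] := label_boundP n_gt0.
apply: leq_trans (_ : (72 * (n * label_bound n * depth n)) ^ 3 <= _).
  by rewrite leq_exp2r // (qspec_nqueries H).
move: 72 => K; rewrite -/(depth n) !expnMn (expnD n 3 2).
move: (K ^ 3) (n ^ 3) (n ^ 2) (label_bound n ^ 3) (depth n ^ 3) le_D => {}K a b x c le_x.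
by rewrite (_ : K * 8 * (a * b) * c = K * (a * (8 * b) * c)) ?leq_mul //; lia.
Qed.
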